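(* Let $q$ be a prime power, let $d\ge 1$ be a divisor of $q-1$, and let $\ell\ge 0$ be an integer. Suppose $f(x)\in\mathbb{F}_q[x]$ has the form $f(x)=x^{\frac{q-1}{d}-\ell}+g(x)$ for some $g(x)\in\mathbb{F}_q[x]$ with $1\le g^\circ<\frac{q-1}{d}-\ell$. Let $\delta=\frac{q-1}{d}-\ell-g^\circ$ be the gap between the exponents of the two highest terms. Then $|Z(f)|\le d(\ell+g^\circ)=q-1-d\delta$.
   Context: For a polynomial $f(x)\in\mathbb{F}_q[x]$, $f^\circ$ denotes its degree and $Z(f)$ denotes the set of (distinct) roots of $f$ lying in $\mathbb{F}_q^*=\mathbb{F}_q\setminus\{0\}$. *)

(* Defs.v *)
From mathcomp Require Import all_boot all_algebra all_field.

Set Implicit Arguments.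
Unset Strict Implicit.
Unset Printing Implicit Defensive.

Import GRing.Theory.
Local Open Scope ring_scope.

(* The zero polynomial gets degree 0. *)
Definition degree (R : nzRingType) (p : {poly R}) : nat := (size p).-1.

Definition Z (F : finFieldType) (f : {poly F}) : {set F} :=
  [set x : F | (x != 0) && root f x].

(* Main.v *)
(** A nonzero root [x] of [f] satisfies [x^((q-1)/d) = - x^l g(x)].  Raising
    this to the power [d] gives [1 = (- x^l g(x))^d], so [x] is a root of
    [(- X^l g)^d - 1], which has degree [d (l + deg g) > 0]. *)

Require Import Defs.
From mathcomp Require Import all_boot all_algebra all_field.

Set Implicit Arguments.
Unset Strict Implicit.
Unset Printing Implicit Defensive.

Import GRing.Theory.
Local Open Scope ring_scope.

(** Degrees multiply by [d] over a domain, and [p ^+ d] is nonconstant, so subtracting 1 leaves its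
    leading term intact. *)
Lemma size_exp_sub1 (R : idomainType) (p : {poly R}) (d : nat) :
  (0 < d)%N -> (0 < degree p)%N -> size (p ^+ d - 1) = (d * degree p).+1.
Proof.
move=> d_gt0 degp.
have sz : size (p ^+ d) = (d * degree p).+1.
  have p0 : p != 0 by apply: contraTneq degp => ->; rewrite /degree size_poly0.
  have : (0 < size (p ^+ d))%N by rewrite size_poly_gt0 expf_neq0.
  by move/prednK <-; rewrite size_exp mulnC.
by rewrite size_polyDl // size_polyN size_poly1 sz ltnS muln_gt0 d_gt0.
Qed.

Lemma degree_opp_XnM (R : idomainType) (p : {poly R}) (l : nat) :
  (0 < degree p)%N -> degree (- ('X^l * p)) = (l + degree p)%N.
Proof.
move=> degp.
have p0 : p != 0 by apply: contraTneq degp => ->; rewrite /degree size_poly0.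
rewrite /degree size_polyN size_monicM ?monicXn // size_polyXn addSn /=.
by rewrite -!subn1 addnBA // size_poly_gt0.
Qed.

Theorem theorem2p1 (q : nat) (F : finFieldType) (hq : #|F| = q)
    (d : nat) (hd1 : (1 <= d)%N) (hd : (d %| q - 1)%N)
    (l : nat) (f g : {poly F})
    (hf : f = 'X^((q - 1) %/ d - l)%N + g)
    (hg1 : (1 <= degree g)%N)
    (hg2 : (degree g < (q - 1) %/ d - l)%N)
    (delta : nat) (hdelta : delta = ((q - 1) %/ d - l - degree g)%N) :
  (#|Z f| <= d * (l + degree g))%N /\
  (d * (l + degree g) = q - 1 - d * delta)%N.
Proof.
set m := ((q - 1) %/ d)%N in hf hg2 hdelta.
have qE : (q - 1 = d * m)%N by rewrite mulnC divnK.
(* Subtraction is truncated: [hg2] makes [m - l] positive, hence a true difference. *)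
have lm : (l <= m)%N by rewrite ltnW // -subn_gt0 (leq_ltn_trans _ hg2).
split; last first.
  rewrite qE hdelta -mulnBr -subnDA subKn //.
  by rewrite -leq_subRL // ltnW.
set h := (- ('X^l * g)) ^+ d - 1.
have sz : size h = (d * (l + degree g)).+1.
  by rewrite size_exp_sub1 ?degree_opp_XnM // addn_gt0 hg1 orbT.
rewrite -ltnS -sz cardE; apply: max_poly_roots (enum_uniq _).
  by rewrite -size_poly_gt0 sz.
apply/allP => x; rewrite mem_enum inE => /andP[x0].
rewrite hf /root !hornerE addrC addr_eq0 => /eqP gx.
(* As [g.[x]] is [- x ^+ (m - l)], the base of the [d]-th power becomes [x ^+ m], and the power
   [x ^+ (q - 1)]. *)
rewrite gx mulrN opprK -exprD subnKC // -exprM mulnC -qE subr_eq0.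
(* Multiplying by the nonzero [x] reduces the claim to [x ^+ q = x], which holds throughout [F]. *)
apply/eqP/(mulIf x0); rewrite -exprSr mul1r -hq subn1 prednK ?expf_card //.
by apply/card_gt0P; exists x.
Qed.
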